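(* $$\sum_{k=1}^\infty\frac{2^k}{k^2\binom{2k}{k}}\left(2S_1(2k)-7S_1(k)+\frac2k\right)=-\frac{\pi^2}{2}\log 2.$$
   Context: $S_1(n):=\sum_{i=1}^n \frac1i$ is the $n$-th harmonic number; $\log$ is the natural logarithm. *)

(* Defs.v *)
From Stdlib Require Import Reals.
From Coquelicot Require Import Coquelicot.
Open Scope R_scope.

Definition S1 (n : nat) : R := sum_n_m (fun i : nat => / INR i) 1 n.

(* Main.v *)
Require Import Defs.
From Stdlib Require Import Reals Lra Lia.
From Coquelicot Require Import Coquelicot.
Open Scope R_scope.

(** With [b k = 4^k / (k^2 C(2k,k))], the series is the value at [x = PI/4] of
    [A(x) = sum_k b k * c k * (sin x)^(2k)], where
    [c k = 2 S1(2k) - 7 S1(k) + 2/k].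

    The recurrence of [b] turns two derivatives in [x] into one difference of
    the weights: if [c 0 = 0], then [A''] has the coefficients
    [2(m+1)(2m+1) b(m+1) (c(m+1) - c m)].  Weights equal to 1 for [k > 0] give
    [sum_k b k (sin x)^(2k) = 2 x^2] ([PSeries_arcsin2]).  The differences of
    the harmonic part of [c] are [2/(2m+1) - 6/(m+1)], so its second derivative
    is again made of the series of [b], hence is elementary
    ([is_derive2_PSeries_harmonic]); the part [2/k] is elementary after a single
    derivative ([is_derive_PSeries_reciprocal]).

    Put [g(x) = x cot x].  Writing [A(PI/4)] as the integral of
    [(PI/4 - x) A''(x)], with the term in [x^2 / sin^2 x] integrated by parts,
    brings it to the form
    [int_0^(PI/4) (-16 (PI/2 - x) g(x) + 40 (PI/4 - x) g(2x)) dx].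
    This is [10 H - 16 H1], where [H] and [H1] are the integrals of
    [(PI/2 - x) g(x)] up to [PI/2] and up to [PI/4].  Both values involve
    [zeta(3)], but only one linear relation between them is needed.
    Folding the interval up to [PI/2] at its midpoint and using
    [x tan x = g(x) - g(2x)] gives [5/4 H = 2 H1 - PI/8 K], where [K], the
    integral of [g] up to [PI/2], equals [PI/2 ln 2] by the same folding
    ([RInt_xcot_PI2], [is_RInt_xcot_combination]). *)

(** * Integrals of x cot x *)

(** The derivative is asked for in the open interval only, because the primitives
    below involve [xcot], whose derivative formula breaks down at 0.  The
    primitive of a continuous extension of [f] differs from [G] by a function
    with zero derivative inside, to which the mean value theorem applies. *)
Lemma is_RInt_derive_open (f G : R -> R) (a b : R) :
  a <= b ->
  (forall x, a <= x <= b -> continuous f x) ->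
  (forall x, a <= x <= b -> continuous G x) ->
  (forall x, a < x < b -> is_derive G x (f x)) ->
  is_RInt f a b (G b - G a).
Proof.
  intros Hab Hf HG Hd.
  destruct (C0_extension_le f a b Hf) as [g [Hg Hgf]].
  assert (Ig : forall x, is_RInt g a x (RInt g a x)).
  { intros x. apply (RInt_correct (V := R_CompleteNormedModule)), (ex_RInt_continuous g).
    intros z _. apply Hg. }
  assert (Dg : forall x, is_derive (fun t => RInt g a t) x (g x)).
  { intros x. apply (is_derive_RInt g _ a).
    - apply filter_forall. intros y. apply Ig.
    - apply Hg. }
  destruct (MVT_gen (fun t => RInt g a t - G t) a b (fun x => g x - f x)) as [c [Hc E]].
  - intros x. rewrite Rmin_left, Rmax_right by lra. intros Hx.
    apply (is_derive_minus (fun t => RInt g a t) G); auto.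
  - intros x. rewrite Rmin_left, Rmax_right by lra. intros Hx.
    apply continuity_pt_filterlim.
    apply (continuous_minus (fun t => RInt g a t) G).
    + apply (ex_derive_continuous (fun t => RInt g a t)). eexists. apply Dg.
    + now apply HG.
  - rewrite Rmin_left, Rmax_right in Hc by lra.
    rewrite (Hgf c Hc), RInt_point in E.
    unfold zero in E; simpl in E.
    replace (G b - G a) with (RInt g a b) by lra.
    apply (is_RInt_ext g); [|apply Ig].
    intros x. rewrite Rmin_left, Rmax_right by lra. intros Hx. apply Hgf. lra.
Qed.

(** The value 1 at 0 is the limit; the formula itself would give 0 there. *)
Definition xcot (x : R) : R :=
  if Req_dec_T x 0 then 1 else x * cos x / sin x.

Lemma xcot_0 : xcot 0 = 1.
Proof. unfold xcot. destruct (Req_dec_T 0 0); lra. Qed.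

Lemma xcot_neq0 (x : R) : x <> 0 -> xcot x = x * cos x / sin x.
Proof. intros H. unfold xcot. destruct (Req_dec_T x 0); lra. Qed.

Lemma is_derive_xcot (x : R) :
  0 < x < PI -> is_derive xcot x (cos x / sin x - x / sin x ^ 2).
Proof.
  intros Hx. assert (Hs : 0 < sin x) by (apply sin_gt_0; lra).
  apply (is_derive_ext_loc (fun t => t * cos t / sin t)).
  - assert (Hp : 0 < x) by lra.
    exists (mkposreal x Hp). intros y Hy.
    unfold ball in Hy; simpl in Hy; unfold AbsRing_ball, abs, minus, plus, opp in Hy; simpl in Hy.
    apply Rabs_def2 in Hy. symmetry. apply xcot_neq0. lra.
  - auto_derive; [lra|]. 
    pose proof (sin2_cos2 x) as E. unfold Rsqr in E.
    replace (cos x / sin x - x / sin x ^ 2)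
      with (cos x / sin x - x * (sin x * sin x + cos x * cos x) / sin x ^ 2)
      by (rewrite E; field; lra).
    field. lra.
Qed.

Lemma continuous_xcot (x : R) : 0 <= x < PI -> continuous xcot x.
Proof.
  intros Hx. destruct (Req_dec x 0) as [->|Hn].
  - apply continuity_pt_filterlim, continuity_pt_filterlim'.
    apply (filterlim_ext_loc (fun t => cos t * / (sin t / t))).
    + exists (mkposreal 1 Rlt_0_1). intros y Hy Hy0.
      rewrite xcot_neq0 by exact Hy0.
      unfold Rdiv. rewrite Rinv_mult, Rinv_inv. ring.
    + rewrite xcot_0.
      replace 1 with (cos 0 * / 1) by (rewrite cos_0; field).
      apply (is_lim_mult cos (fun t => / (sin t / t)) 0 (cos 0) (/ 1)).
      * apply is_lim_continuity. apply continuity_cos.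
      * apply (is_lim_inv (fun t => sin t / t) 0 1 is_lim_sinc_0).
        intros H; injection H; lra.
      * exact I.
  - apply (ex_derive_continuous xcot). eexists. apply is_derive_xcot. lra.
Qed.

(** This is [cot x - tan x = 2 cot 2x] multiplied by [x]. *)
Lemma xcot_double (x : R) :
  0 <= x <= PI / 4 -> x * tan x = xcot x - xcot (2 * x).
Proof.
  intros Hx. destruct (Req_dec x 0) as [->|Hn].
  - rewrite Rmult_0_r, xcot_0. ring.
  - pose proof PI_RGT_0.
    assert (0 < sin x) by (apply sin_gt_0; lra).
    assert (0 < cos x) by (apply cos_gt_0; lra).
    rewrite !xcot_neq0 by lra. unfold tan.
    rewrite sin_2a, cos_2a. field. lra.
Qed.

Lemma xcot_compl (x : R) : x <> PI / 2 -> xcot (PI / 2 - x) = (PI / 2 - x) * tan x.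
Proof.
  intros Hx. rewrite xcot_neq0 by lra.
  rewrite cos_shift, sin_shift. unfold tan, Rdiv. ring.
Qed.

Lemma is_RInt_tan : is_RInt tan 0 (PI / 4) (ln 2 / 2).
Proof.
  pose proof PI_RGT_0.
  assert (Hc : forall x, 0 <= x <= PI / 4 -> 0 < cos x) by (intros; apply cos_gt_0; lra).
  replace (ln 2 / 2) with ((- ln (cos (PI / 4))) - (- ln (cos 0))).
  - apply (is_RInt_derive_open tan (fun x => - ln (cos x))); [lra| | |].
    + intros x Hx. apply (ex_derive_continuous tan).
      specialize (Hc x Hx). unfold tan. auto_derive. lra.
    + intros x Hx. apply (ex_derive_continuous (fun x => - ln (cos x))).
      specialize (Hc x Hx). auto_derive. lra.
    + intros x Hx. specialize (Hc x ltac:(lra)).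
      auto_derive; [lra|]. unfold tan. field. lra.
  - rewrite cos_0, ln_1, cos_PI4.
    assert (0 < sqrt 2) by (apply sqrt_lt_R0; lra).
    replace (1 / sqrt 2) with (/ sqrt 2) by (field; lra).
    rewrite ln_Rinv by assumption.
    replace (ln 2) with (ln (sqrt 2 * sqrt 2)) by (rewrite sqrt_sqrt; lra).
    rewrite ln_mult by assumption. field.
Qed.

(** The upper half of the interval is reflected by [x -> PI/2 - x], which turns
    the cotangent into a tangent. *)
Lemma RInt_xcot_fold (u : R -> R) :
  (forall x, continuous u x) ->
  RInt (fun x => u x * xcot x) 0 (PI / 2) =
  RInt (fun x => u x * xcot x) 0 (PI / 4)
  + RInt (fun x => u (PI / 2 - x) * ((PI / 2 - x) * tan x)) 0 (PI / 4).
Proof.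
  intros Hu. pose proof PI_RGT_0.
  assert (Hc : forall x, 0 <= x < PI -> continuous (fun x => u x * xcot x) x).
  { intros x Hx. apply (continuous_mult u xcot); [apply Hu|now apply continuous_xcot]. }
  assert (Hi : forall a b, 0 <= a < PI -> 0 <= b < PI -> ex_RInt (fun x => u x * xcot x) a b).
  { intros a b Ha Hb. apply (ex_RInt_continuous (fun x => u x * xcot x)).
    intros z Hz. apply Hc. unfold Rmin, Rmax in Hz. destruct (Rle_dec a b); lra. }
  rewrite <- (RInt_Chasles (fun x => u x * xcot x) 0 (PI / 4) (PI / 2)) by (apply Hi; lra).
  unfold plus; simpl. f_equal.
  pose proof (RInt_comp_lin (fun x => u x * xcot x) (-1) (PI / 2) (PI / 4) 0) as E.
  replace (-1 * (PI / 4) + PI / 2) with (PI / 4) in E by field.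
  replace (-1 * 0 + PI / 2) with (PI / 2) in E by field.
  rewrite <- E by (apply Hi; lra).
  rewrite <- opp_RInt_swap.
  - rewrite <- (RInt_opp (fun y => scal (-1) (u (-1 * y + PI / 2) * xcot (-1 * y + PI / 2)))).
    + apply RInt_ext. intros x. rewrite Rmin_left, Rmax_right by lra. intros Hx.
      replace (-1 * x + PI / 2) with (PI / 2 - x) by ring.
      rewrite xcot_compl by lra.
      unfold opp, scal; simpl; unfold mult; simpl. ring.
    + apply ex_RInt_swap. apply (ex_RInt_comp_lin (fun x => u x * xcot x) (-1) (PI / 2) (PI / 4) 0).
      replace (-1 * (PI / 4) + PI / 2) with (PI / 4) by field.
      replace (-1 * 0 + PI / 2) with (PI / 2) by field. apply Hi; lra.
  - apply (ex_RInt_comp_lin (fun x => u x * xcot x) (-1) (PI / 2) 0 (PI / 4)).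
    replace (-1 * (PI / 4) + PI / 2) with (PI / 4) by field.
    replace (-1 * 0 + PI / 2) with (PI / 2) by field. apply Hi; lra.
Qed.

Lemma is_RInt_xcot_double (u : R -> R) :
  (forall x, continuous u x) ->
  is_RInt (fun x => u (2 * x) * xcot (2 * x)) 0 (PI / 4)
    (RInt (fun x => u x * xcot x) 0 (PI / 2) / 2).
Proof.
  intros Hu. pose proof PI_RGT_0.
  assert (Hi : is_RInt (fun x => u x * xcot x) (2 * 0 + 0) (2 * (PI / 4) + 0)
     (RInt (fun x => u x * xcot x) 0 (PI / 2))).
  { replace (2 * 0 + 0) with 0 by ring.
    replace (2 * (PI / 4) + 0) with (PI / 2) by field.
    apply (RInt_correct (V := R_CompleteNormedModule)), (ex_RInt_continuous (fun x => u x * xcot x)).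
    intros z. rewrite Rmin_left, Rmax_right by lra. intros Hz.
    apply (continuous_mult u xcot); [apply Hu|apply continuous_xcot; lra]. }
  apply is_RInt_comp_lin in Hi.
  apply (is_RInt_scal _ _ _ (/ 2)) in Hi.
  replace (_ / 2) with (scal (/ 2) (RInt (fun x => u x * xcot x) 0 (PI / 2))).
  - revert Hi. apply is_RInt_ext. intros x _.
    rewrite Rplus_0_r. unfold scal; simpl; unfold mult; simpl. field.
  - unfold scal; simpl; unfold mult; simpl. field.
Qed.

Lemma is_RInt_xcot (u : R -> R) (b : R) :
  (forall x, continuous u x) -> 0 <= b < PI ->
  is_RInt (fun x => u x * xcot x) 0 b (RInt (fun x => u x * xcot x) 0 b).
Proof.
  intros Hu Hb.
  apply (RInt_correct (V := R_CompleteNormedModule)), (ex_RInt_continuous (fun x => u x * xcot x)).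
  intros z. rewrite Rmin_left, Rmax_right by lra. intros Hz.
  apply (continuous_mult u xcot); [apply Hu|apply continuous_xcot; lra].
Qed.

(** Folding expresses the integral [K] of [xcot] through itself: since
    [(PI/2 - x) tan x = PI/2 tan x - xcot x + xcot (2 x)], the integrals of
    [xcot] up to [PI/4] cancel and [K = PI/4 ln 2 + K/2] remains.  The factor 1
    matches the weight in [RInt_xcot_fold]. *)
Lemma RInt_xcot_PI2 : RInt (fun x => 1 * xcot x) 0 (PI / 2) = PI / 2 * ln 2.
Proof.
  pose proof PI_RGT_0.
  assert (C1 : forall x : R, continuous (fun _ => 1) x) by (intros; apply continuous_const).
  pose proof (RInt_xcot_fold _ C1) as E. simpl in E.
  assert (I : is_RInt (fun x => 1 * ((PI / 2 - x) * tan x)) 0 (PI / 4)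
     (PI / 2 * (ln 2 / 2) - RInt (fun x => 1 * xcot x) 0 (PI / 4)
       + RInt (fun x => 1 * xcot x) 0 (PI / 2) / 2)).
  { apply (is_RInt_ext
      (fun x => plus (minus (scal (PI / 2) (tan x)) (1 * xcot x)) (1 * xcot (2 * x)))).
    - intros x. rewrite Rmin_left, Rmax_right by lra. intros Hx.
      unfold plus, minus, plus, opp, scal; simpl; unfold mult; simpl.
      rewrite Rmult_1_l, Rmult_minus_distr_r, xcot_double by lra. ring.
    - apply (is_RInt_plus (V := R_NormedModule)); [apply (is_RInt_minus (V := R_NormedModule))|].
      + apply (is_RInt_scal (V := R_NormedModule)), is_RInt_tan.
      + apply (is_RInt_xcot (fun _ => 1)); [exact C1|lra].
      + apply (is_RInt_xcot_double (fun _ => 1)), C1. }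
  rewrite (is_RInt_unique _ _ _ _ I) in E. lra.
Qed.

(** With the weight [u x = PI/2 - x], folding produces
    [u x * (x tan x) = u x * (xcot x - xcot (2 x))], and
    [u x = PI/4 + u (2 x) / 2] brings the last term back to the integrals of
    [xcot] and [u * xcot] over the whole interval.  This is a linear relation
    between the integrals of [u * xcot] up to [PI/4] and up to [PI/2]; the
    combination below is a multiple of it, so neither value is needed. *)
Lemma is_RInt_xcot_combination :
  is_RInt (fun x => -16 * ((PI / 2 - x) * xcot x)
                    + 40 * ((PI / 4 - x) * xcot (2 * x)))
    0 (PI / 4) (- (PI ^ 2 / 2) * ln 2).
Proof.
  pose proof PI_RGT_0.
  set (u := fun x => PI / 2 - x).
  assert (Cu : forall x : R, continuous u x).
  { intros x. apply (continuous_minus (fun _ => PI / 2) (fun x => x));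
      [apply continuous_const|apply continuous_id]. }
  assert (C1 : forall x : R, continuous (fun _ => 1) x) by (intros; apply continuous_const).
  assert (Hb4 : 0 <= PI / 4 < PI) by lra.
  pose proof (is_RInt_xcot u _ Cu Hb4) as I4.
  pose proof (is_RInt_xcot_double u Cu) as Id.
  pose proof (is_RInt_xcot_double _ C1) as I1. cbv beta in I1.
  pose proof (RInt_xcot_fold u Cu) as E.
  set (H1 := RInt (fun x => u x * xcot x) 0 (PI / 4)) in *.
  set (H2 := RInt (fun x => u x * xcot x) 0 (PI / 2)) in *.
  rewrite RInt_xcot_PI2 in I1.
  assert (I : is_RInt (fun x => u (PI / 2 - x) * ((PI / 2 - x) * tan x)) 0 (PI / 4)
     (H1 - (PI / 4 * (PI / 2 * ln 2 / 2) + / 2 * (H2 / 2)))).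
  { apply (is_RInt_ext
      (fun x => minus (u x * xcot x)
         (plus (scal (PI / 4) (1 * xcot (2 * x))) (scal (/ 2) (u (2 * x) * xcot (2 * x)))))).
    - intros x. rewrite Rmin_left, Rmax_right by lra. intros Hx.
      unfold plus, minus, plus, opp, scal; simpl; unfold mult; simpl. unfold u.
      replace ((PI / 2 - (PI / 2 - x)) * ((PI / 2 - x) * tan x))
        with ((PI / 2 - x) * (x * tan x)) by ring.
      rewrite xcot_double by lra. field.
    - apply (is_RInt_minus (V := R_NormedModule)); [|apply (is_RInt_plus (V := R_NormedModule))].
      + exact I4.
      + apply (is_RInt_scal (V := R_NormedModule)), I1.
      + apply (is_RInt_scal (V := R_NormedModule)), Id. }
  rewrite (is_RInt_unique _ _ _ _ I) in E.
  replace (- (PI ^ 2 / 2) * ln 2) with (-16 * H1 + 20 * (H2 / 2)) by nra.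
  apply (is_RInt_ext
      (fun x => plus (scal (-16) (u x * xcot x)) (scal 20 (u (2 * x) * xcot (2 * x))))).
  - intros x _. unfold plus, scal; simpl; unfold mult; simpl. unfold u. field.
  - apply (is_RInt_plus (V := R_NormedModule)); apply (is_RInt_scal (V := R_NormedModule)).
    + exact I4.
    + exact Id.
Qed.

(** * Power series in the square of the sine *)

Lemma is_derive_PSeries_sin2 (a : nat -> R) (x : R) :
  Rbar_lt (Rabs (sin x ^ 2)) (CV_radius a) ->
  is_derive (fun t => PSeries a (sin t ^ 2)) x
    (2 * sin x * cos x * PSeries (PS_derive a) (sin x ^ 2)).
Proof.
  intros Ha.
  apply (is_derive_comp (PSeries a) (fun t => sin t ^ 2)).
  - now apply is_derive_PSeries.
  - auto_derive; [exact I|ring].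
Qed.

(** With [y = sin^2 x], two derivatives in [x] are
    [4 y (1 - y) d^2/dy^2 + 2 (1 - 2 y) d/dy], which maps [y^k] to
    [2 k (2k - 1) y^(k-1) - 4 k^2 y^k]. *)
Lemma is_derive2_PSeries_sin2 (a : nat -> R) (x : R) :
  Rbar_lt (Rabs (sin x ^ 2)) (CV_radius a) ->
  is_derive (fun t => 2 * sin t * cos t * PSeries (PS_derive a) (sin t ^ 2)) x
    (PSeries (fun m => 2 * INR (S m) * (2 * INR m + 1) * a (S m) - 4 * INR m ^ 2 * a m)
       (sin x ^ 2)).
Proof.
  intros Ha. set (y := sin x ^ 2) in *.
  assert (Hd : Rbar_lt (Rabs y) (CV_radius (PS_derive a))) by now rewrite CV_radius_derive.
  assert (He : Rbar_lt (Rabs y) (CV_radius (PS_derive (PS_derive a))))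
    by now rewrite CV_radius_derive.
  pose proof (PSeries_correct _ _ (CV_radius_inside _ _ Hd)) as P1.
  pose proof (PSeries_correct _ _ (CV_radius_inside _ _ He)) as P2.
  set (d := PS_derive a) in *. set (e := PS_derive d) in *.
  set (s1 := PSeries d y) in *. set (s2 := PSeries e y) in *.
  assert (P : is_pseries
     (fun m => 2 * INR (S m) * (2 * INR m + 1) * a (S m) - 4 * INR m ^ 2 * a m) y
     (2 * s1 + (-4 * (y * s1) + (4 * (y * s2) + -4 * (y * (y * s2)))))).
  { apply (is_pseries_ext
      (PS_plus (PS_scal 2 d) (PS_plus (PS_scal (-4) (PS_incr_1 d))
         (PS_plus (PS_scal 4 (PS_incr_1 e)) (PS_scal (-4) (PS_incr_1 (PS_incr_1 e))))))).
    - intros [|[|n]];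
        unfold PS_plus, PS_scal, PS_incr_1, d, e, PS_derive, d, PS_derive,
          plus, scal, zero; cbn [AbelianMonoid.plus Ring.sort]; simpl;
        unfold mult; simpl; ring.
    - assert (S : forall (k : R) (f : nat -> R) (l : R),
        is_pseries f y l -> is_pseries (PS_scal k f) y (k * l)).
      { intros k f l. apply (is_pseries_scal (V := R_NormedModule)). apply Rmult_comm. }
      assert (I : forall (f : nat -> R) (l : R),
        is_pseries f y l -> is_pseries (PS_incr_1 f) y (y * l)).
      { intros f l. apply (is_pseries_incr_1 (V := R_NormedModule)). }
      apply (is_pseries_plus (V := R_NormedModule)); [now apply S|].
      apply (is_pseries_plus (V := R_NormedModule)); [now apply S, I|].
      apply (is_pseries_plus (V := R_NormedModule)); [now apply S, I|].
      now apply S, I, I. }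
  rewrite (is_pseries_unique _ _ _ P).
  pose proof (sin2_cos2 x) as T. unfold Rsqr in T.
  assert (Hc : cos x * cos x = 1 - y) by (unfold y; lra).
  evar_last.
  - apply (is_derive_mult (fun t => 2 * sin t * cos t) (fun t => PSeries d (sin t ^ 2))).
    + auto_derive; [exact I|reflexivity].
    + apply is_derive_PSeries_sin2. exact Hd.
    + intros; apply Rmult_comm.
  - unfold plus, mult; simpl. fold (y). unfold y at 1. fold e s1 s2.
    change (sin x * (sin x * 1)) with y. fold s1 s2.
    replace (2 * sin x * cos x * (2 * sin x * cos x * s2))
      with (4 * (sin x ^ 2) * (cos x * cos x) * s2) by ring.
    fold y. rewrite Hc.
    replace (_ * s1 + _) with ((2 * (cos x * cos x) - 2 * sin x ^ 2) * s1 + 4 * y * (1 - y) * s2)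
      by ring.
    fold y. rewrite Hc. ring.
Qed.

(** The coefficients of [2 arcsin(s)^2] in powers of [s^2], see
    [PSeries_arcsin2].  The value at 0 is 0, since [/ 0 = 0]. *)
Definition arcsin2_coef (k : nat) : R := 4 ^ k / (INR k ^ 2 * Binomial.C (2 * k) k).

Lemma arcsin2_coef_0 : arcsin2_coef 0 = 0.
Proof. unfold arcsin2_coef. simpl INR. rewrite pow_i, Rmult_0_l by lia. unfold Rdiv. rewrite Rinv_0. ring. Qed.

Lemma central_binomial_pos (k : nat) : 0 < Binomial.C (2 * k) k.
Proof.
  unfold Binomial.C. apply Rdiv_lt_0_compat; [|apply Rmult_lt_0_compat]; apply INR_fact_lt_0.
Qed.

Lemma central_binomial_S (m : nat) :
  INR (S m) * Binomial.C (2 * S m) (S m) = 2 * (2 * INR m + 1) * Binomial.C (2 * m) m.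
Proof.
  unfold Binomial.C.
  replace (2 * S m - S m)%nat with (S m) by lia.
  replace (2 * m - m)%nat with m by lia.
  replace (2 * S m)%nat with (S (S (2 * m))) by lia.
  rewrite !fact_simpl, !mult_INR.
  rewrite (S_INR (S _)), !S_INR, mult_INR. simpl (INR 2).
  pose proof (pos_INR m). pose proof (INR_fact_neq_0 m).
  field. split; [assumption|lra].
Qed.

Lemma arcsin2_coef_1 : arcsin2_coef 1 = 2.
Proof.
  unfold arcsin2_coef. pose proof (central_binomial_S 0) as E.
  unfold Binomial.C at 2 in E. simpl in E. simpl.
  replace (Binomial.C 2 1) with 2 by lra. field.
Qed.

(** The two sides, doubled, are the two terms of the coefficient of index [m] in
    [is_derive2_PSeries_sin2], which therefore cancel for [a = arcsin2_coef]. *)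
Lemma arcsin2_coef_S (m : nat) :
  (0 < m)%nat -> INR (S m) * (2 * INR m + 1) * arcsin2_coef (S m) = 2 * INR m ^ 2 * arcsin2_coef m.
Proof.
  intros Hm. unfold arcsin2_coef.
  pose proof (central_binomial_S m) as E.
  pose proof (central_binomial_pos m) as P. pose proof (central_binomial_pos (S m)) as P'.
  set (C' := Binomial.C (2 * S m) (S m)) in *. set (C := Binomial.C (2 * m) m) in *.
  assert (Hm' : 0 < INR m) by now apply lt_0_INR.
  rewrite S_INR in *. simpl (4 ^ S m).
  replace C' with (2 * (2 * INR m + 1) * C / (INR m + 1)) by (rewrite <- E; field; lra).
  field. repeat split; lra.
Qed.

Lemma arcsin2_coef_bounds (k : nat) : 0 <= INR k * arcsin2_coef k <= 2.
Proof.
  induction k as [|m IH].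
  - simpl INR. lra.
  - destruct m as [|n].
    + rewrite arcsin2_coef_1. simpl. lra.
    + set (m := S n) in *.
      assert (Hm : 0 < INR m) by (apply lt_0_INR; unfold m; lia).
      pose proof (arcsin2_coef_S m ltac:(unfold m; lia)) as E.
      assert (E' : INR (S m) * arcsin2_coef (S m) = 2 * INR m / (2 * INR m + 1) * (INR m * arcsin2_coef m)).
      { apply (Rmult_eq_reg_l (2 * INR m + 1)); [|lra].
        transitivity (2 * INR m ^ 2 * arcsin2_coef m); [rewrite <- E; ring|field; lra]. }
      rewrite E'.
      assert (0 <= 2 * INR m / (2 * INR m + 1) <= 1).
      { split.
        - apply Rdiv_le_0_compat; lra.
        - apply (Rmult_le_reg_r (2 * INR m + 1)); [lra|].
          unfold Rdiv. rewrite Rmult_assoc, Rinv_l by lra. lra. }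
      nra.
Qed.

(** The coefficients are [O(1/k)], so a weight of linear growth keeps them
    bounded. *)
Lemma CV_radius_arcsin2_mul (c : nat -> R) (M : R) :
  (forall k, Rabs (c k) <= M * INR (S k)) ->
  Rbar_le 1 (CV_radius (fun k => arcsin2_coef k * c k)).
Proof.
  intros Hc. apply (CV_radius_bounded (fun k => arcsin2_coef k * c k)).
  exists (4 * M). intros k. rewrite pow1, Rmult_1_r, Rabs_mult.
  assert (HM : 0 <= M).
  { specialize (Hc 0%nat). simpl in Hc. pose proof (Rabs_pos (c 0%nat)). lra. }
  specialize (Hc k).
  pose proof (arcsin2_coef_bounds k) as B. pose proof (pos_INR k) as K.
  assert (Hb : 0 <= arcsin2_coef k /\ arcsin2_coef k * INR (S k) <= 4).
  { rewrite S_INR. destruct k as [|k].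
    - rewrite arcsin2_coef_0. simpl. lra.
    - assert (1 <= INR (S k)) by (rewrite S_INR; pose proof (pos_INR k); lra). nra. }
  rewrite (Rabs_pos_eq (arcsin2_coef k)) by apply Hb.
  apply Rle_trans with (arcsin2_coef k * (M * INR (S k))).
  - apply Rmult_le_compat_l; [apply Hb|exact Hc].
  - replace (arcsin2_coef k * (M * INR (S k))) with (M * (arcsin2_coef k * INR (S k))) by ring.
    rewrite (Rmult_comm 4). now apply Rmult_le_compat_l.
Qed.

Lemma sin2_in_disk (a : nat -> R) (x : R) :
  Rbar_le 1 (CV_radius a) -> - (PI / 2) < x < PI / 2 ->
  Rbar_lt (Rabs (sin x ^ 2)) (CV_radius a).
Proof.
  intros Ha Hx. apply Rbar_lt_le_trans with (2 := Ha). simpl.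
  assert (0 < cos x) by (apply cos_gt_0; lra).
  pose proof (sin2_cos2 x) as T. unfold Rsqr in T.
  rewrite Rabs_pos_eq; nra.
Qed.

Lemma CV_radius_arcsin2 : Rbar_le 1 (CV_radius arcsin2_coef).
Proof.
  rewrite (CV_radius_ext arcsin2_coef (fun k => arcsin2_coef k * 1)) by (intros; ring).
  apply (CV_radius_arcsin2_mul (fun _ => 1) 1). intros k.
  rewrite Rabs_R1, S_INR. pose proof (pos_INR k). lra.
Qed.

Lemma eq_of_is_derive (F G df : R -> R) (x : R) :
  0 <= x ->
  (forall t, 0 <= t <= x -> is_derive F t (df t)) ->
  (forall t, 0 <= t <= x -> is_derive G t (df t)) ->
  F 0 = G 0 -> F x = G x.
Proof.
  intros Hx HF HG H0. destruct (Rle_lt_or_eq_dec _ _ Hx) as [Hx'|<-]; [|exact H0].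
  assert (E : F 0 - G 0 = F x - G x).
  { apply (eq_is_derive (V := R_NormedModule) (fun t => F t - G t)); [|exact Hx'].
    intros t Ht. change (is_derive (fun t => F t - G t) t 0). rewrite <- (Rminus_diag_eq _ _ (eq_refl (df t))).
    apply (is_derive_minus F G); auto. }
  lra.
Qed.

(** The second derivative of the series is the constant 4: by [arcsin2_coef_S],
    only the coefficient of index 0 survives. *)
Lemma PSeries_derive_arcsin2 (x : R) :
  0 <= x < PI / 2 -> 2 * sin x * cos x * PSeries (PS_derive arcsin2_coef) (sin x ^ 2) = 4 * x.
Proof.
  intros Hx.
  apply (eq_of_is_derive (fun t => 2 * sin t * cos t * PSeries (PS_derive arcsin2_coef) (sin t ^ 2))
           (fun t => 4 * t) (fun _ => 4)).
  - lra.
  - intros t Ht.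
    evar_last.
    + apply is_derive2_PSeries_sin2, sin2_in_disk; [apply CV_radius_arcsin2|lra].
    + apply is_pseries_unique, is_pseries_R.
      (* [4 * 0 ^ m] is a geometric form of the coefficients of the constant 4 *)
      apply (is_series_ext (fun m => scal 4 (0 ^ m))).
      * intros [|n].
        -- rewrite arcsin2_coef_1, arcsin2_coef_0. unfold scal; simpl; unfold mult; simpl. ring.
        -- pose proof (arcsin2_coef_S (S n) ltac:(lia)) as E.
           rewrite pow_i by lia. unfold scal; simpl; unfold mult; simpl.
           replace (_ - _) with 0; [ring|]. simpl in E. lra.
      * evar_last.
        -- apply (is_series_scal (V := R_NormedModule)), is_series_geom. rewrite Rabs_R0. lra.
        -- unfold scal; simpl; unfold mult; simpl. field.
  - intros t _. auto_derive; [exact I|ring].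
  - rewrite sin_0. ring.
Qed.

Lemma PSeries_arcsin2 (x : R) : 0 <= x < PI / 2 -> PSeries arcsin2_coef (sin x ^ 2) = 2 * x ^ 2.
Proof.
  intros Hx.
  apply (eq_of_is_derive (fun t => PSeries arcsin2_coef (sin t ^ 2)) (fun t => 2 * t ^ 2) (fun t => 4 * t)).
  - lra.
  - intros t Ht. rewrite <- PSeries_derive_arcsin2 by lra.
    apply is_derive_PSeries_sin2, sin2_in_disk; [apply CV_radius_arcsin2|lra].
  - intros t _. auto_derive; [exact I|ring].
  - rewrite sin_0. replace (0 ^ 2) with 0 by ring. rewrite PSeries_0, arcsin2_coef_0. ring.
Qed.

(** * Harmonic weights *)

Lemma S1_0 : S1 0 = 0.
Proof. unfold S1. now rewrite sum_n_m_zero by lia. Qed.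

Lemma S1_S (n : nat) : S1 (S n) = S1 n + / INR (S n).
Proof. unfold S1. now rewrite sum_n_Sm by lia. Qed.

Lemma S1_bounds (n : nat) : 0 <= S1 n <= INR n.
Proof.
  induction n as [|n IH].
  - rewrite S1_0. simpl. lra.
  - rewrite S1_S. rewrite S_INR. pose proof (pos_INR n).
    assert (0 < / (INR n + 1) <= / 1).
    { split; [apply Rinv_0_lt_compat; lra|apply Rinv_le_contravar; lra]. }
    lra.
Qed.

Definition harmonic_weight (k : nat) : R := 2 * S1 (2 * k) - 7 * S1 k.

Lemma harmonic_weight_S (m : nat) : harmonic_weight (S m) = harmonic_weight m + (2 / (2 * INR m + 1) - 6 / (INR m + 1)).
Proof.
  unfold harmonic_weight. replace (2 * S m)%nat with (S (S (2 * m))) by lia.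
  rewrite !S1_S, !S_INR, mult_INR. simpl (INR 2). pose proof (pos_INR m).
  field. lra.
Qed.

Definition harmonic_coef (k : nat) : R := arcsin2_coef k * harmonic_weight k.
Definition reciprocal_coef (k : nat) : R := arcsin2_coef k * (2 / INR k).

Lemma CV_radius_harmonic : Rbar_le 1 (CV_radius harmonic_coef).
Proof.
  apply (CV_radius_arcsin2_mul harmonic_weight 11). intros k. unfold harmonic_weight.
  pose proof (S1_bounds k). pose proof (S1_bounds (2 * k)) as B. pose proof (pos_INR k).
  rewrite mult_INR in B. simpl (INR 2) in B. rewrite S_INR.
  apply Rabs_le. lra.
Qed.

Lemma CV_radius_reciprocal : Rbar_le 1 (CV_radius reciprocal_coef).
Proof.
  apply (CV_radius_arcsin2_mul (fun k => 2 / INR k) 2). intros [|k].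
  - simpl. unfold Rdiv. rewrite Rinv_0, Rmult_0_r, Rabs_R0. lra.
  - rewrite !S_INR. pose proof (pos_INR k).
    assert (0 < / (INR k + 1) <= / 1).
    { split; [apply Rinv_0_lt_compat; lra|apply Rinv_le_contravar; lra]. }
    unfold Rdiv. rewrite Rabs_pos_eq; lra.
Qed.

(** The factor [k] from differentiation cancels [2/k], so that [y] times the
    derivative in [y = sin^2 x] is twice the series of [2 x^2]; then
    [dy/dx = 2 sin x cos x]. *)
Lemma is_derive_PSeries_reciprocal (x : R) :
  0 < x < PI / 2 -> is_derive (fun t => PSeries reciprocal_coef (sin t ^ 2)) x (8 * x * xcot x).
Proof.
  intros Hx. set (y := sin x ^ 2).
  assert (Hs : 0 < sin x) by (apply sin_gt_0; lra).
  assert (E : y * PSeries (PS_derive reciprocal_coef) y = 2 * (2 * x ^ 2)).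
  { rewrite <- PSeries_arcsin2 by lra. fold y.
    rewrite <- (PSeries_incr_1 (PS_derive reciprocal_coef) y), <- (PSeries_scal 2 arcsin2_coef y).
    apply PSeries_ext. intros [|n]; unfold PS_incr_1, PS_scal, PS_derive, reciprocal_coef, zero, scal; simpl;
      unfold mult; simpl.
    - rewrite arcsin2_coef_0. ring.
    - change (match n with O => 1 | S _ => INR n + 1 end) with (INR (S n)).
      field. apply not_0_INR. lia. }
  evar_last.
  - apply is_derive_PSeries_sin2, sin2_in_disk; [apply CV_radius_reciprocal|lra].
  - fold y.
    replace (PSeries (PS_derive reciprocal_coef) y) with (2 * (2 * x ^ 2) / y).
    + rewrite xcot_neq0 by lra. unfold y. field. lra.
    + rewrite <- E. field. unfold y. apply pow_nonzero. lra.
Qed.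

(** By [arcsin2_coef_S] and [harmonic_weight_S] the coefficients of the second
    derivative are
    [b(m+1) (4 (m+1) - 12 (2m+1)) = -20 (m+1) b(m+1) + 12 b(m+1)].  With
    [p(y) = sum_k b k y^k = 2 x^2] at [y = sin^2 x], the series is thus
    [-20 p'(y) + 12 p(y) / y]. *)
Lemma is_derive2_PSeries_harmonic (x : R) :
  0 < x < PI / 2 ->
  is_derive (fun t => 2 * sin t * cos t * PSeries (PS_derive harmonic_coef) (sin t ^ 2)) x
    (-40 * x / (sin x * cos x) + 24 * x ^ 2 / sin x ^ 2).
Proof.
  intros Hx. set (y := sin x ^ 2).
  assert (Hs : 0 < sin x) by (apply sin_gt_0; lra).
  assert (Hc : 0 < cos x) by (apply cos_gt_0; lra).
  assert (Hy : Rbar_lt (Rabs y) (CV_radius arcsin2_coef)).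
  { apply sin2_in_disk; [apply CV_radius_arcsin2|lra]. }
  assert (Hy0 : y <> 0) by (apply pow_nonzero; lra).
  pose proof (PSeries_derive_arcsin2 x ltac:(lra)) as E1. fold y in E1.
  pose proof (PSeries_arcsin2 x ltac:(lra)) as E0. fold y in E0.
  rewrite (PSeries_decr_1_aux arcsin2_coef y arcsin2_coef_0) in E0.
  evar_last.
  - apply is_derive2_PSeries_sin2, sin2_in_disk; [apply CV_radius_harmonic|lra].
  - fold y.
    rewrite (PSeries_ext _ (PS_plus (PS_scal (-20) (PS_derive arcsin2_coef)) (PS_scal 12 (PS_decr_1 arcsin2_coef)))).
    + rewrite PSeries_plus, !PSeries_scal.
      * replace (PSeries (PS_derive arcsin2_coef) y) with (4 * x / (2 * sin x * cos x))
          by (rewrite <- E1; field; lra).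
        replace (PSeries (PS_decr_1 arcsin2_coef) y) with (2 * x ^ 2 / y)
          by (rewrite <- E0; field; lra).
        unfold y. field. lra.
      * apply (ex_pseries_scal (V := R_NormedModule)); [apply Rmult_comm|].
        apply CV_radius_inside. now rewrite CV_radius_derive.
      * apply (ex_pseries_scal (V := R_NormedModule)); [apply Rmult_comm|].
        apply CV_radius_inside. now rewrite CV_radius_decr_1.
    + intros m. unfold PS_plus, PS_scal, PS_derive, PS_decr_1, harmonic_coef, plus, scal; simpl AbelianMonoid.plus.
      unfold mult; cbn -[INR arcsin2_coef harmonic_weight S1 Nat.mul].
      assert (R : 2 * INR (S m) * (2 * INR m + 1) * arcsin2_coef (S m) * harmonic_weight m = 4 * INR m ^ 2 * arcsin2_coef m * harmonic_weight m).
      { destruct m as [|n].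
        - replace (harmonic_weight 0) with 0; [ring|]. unfold harmonic_weight. simpl Nat.mul. rewrite S1_0. ring.
        - pose proof (arcsin2_coef_S (S n) ltac:(lia)) as E.
          replace (4 * INR (S n) ^ 2 * arcsin2_coef (S n)) with (2 * (2 * INR (S n) ^ 2 * arcsin2_coef (S n))) by ring.
          rewrite <- E. ring. }
      change (match m with O => 1 | S _ => INR m + 1 end) with (INR (S m)).
      rewrite harmonic_weight_S.
      pose proof (pos_INR m).
      transitivity (2 * INR (S m) * (2 * INR m + 1) * arcsin2_coef (S m)
          * (2 / (2 * INR m + 1) - 6 / (INR m + 1))
        + (2 * INR (S m) * (2 * INR m + 1) * arcsin2_coef (S m) * harmonic_weight m - 4 * INR m ^ 2 * arcsin2_coef m * harmonic_weight m)).
      * ring.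
      * rewrite R. rewrite !S_INR. field. lra.
Qed.

(** The first two terms form a primitive of [(PI/4 - t) F''(t)], where [F] is the
    series with the harmonic weight.  The last one removes
    [24 t^2 / sin^2 t] from [F'']: the derivative of [t xcot t] is
    [2 xcot t - t^2 / sin^2 t].  What is left depends on [xcot] and
    [t tan t] only. *)
Lemma is_derive_combination (x : R) :
  0 < x < PI / 4 ->
  is_derive
    (fun t => (PI / 4 - t) * (2 * sin t * cos t * PSeries (PS_derive harmonic_coef) (sin t ^ 2))
              + PSeries harmonic_coef (sin t ^ 2) + PSeries reciprocal_coef (sin t ^ 2)
              + 24 * (PI / 4 - t) * t * xcot t) x
    (-16 * ((PI / 2 - x) * xcot x) + 40 * ((PI / 4 - x) * xcot (2 * x))).
Proof.
  intros Hx.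
  assert (Hs : 0 < sin x) by (apply sin_gt_0; lra).
  assert (Hc : 0 < cos x) by (apply cos_gt_0; lra).
  evar_last.
  - apply (is_derive_plus (V := R_NormedModule));
      [apply (is_derive_plus (V := R_NormedModule));
        [apply (is_derive_plus (V := R_NormedModule))|]|].
    + apply (is_derive_mult (fun t => PI / 4 - t)
        (fun t => 2 * sin t * cos t * PSeries (PS_derive harmonic_coef) (sin t ^ 2))).
      * auto_derive; [exact I|reflexivity].
      * apply is_derive2_PSeries_harmonic. lra.
      * intros; apply Rmult_comm.
    + apply is_derive_PSeries_sin2, sin2_in_disk; [apply CV_radius_harmonic|lra].
    + apply is_derive_PSeries_reciprocal. lra.
    + apply (is_derive_mult (fun t => 24 * (PI / 4 - t) * t) xcot).
      * auto_derive; [exact I|reflexivity].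
      * apply is_derive_xcot. lra.
      * intros; apply Rmult_comm.
  - replace (xcot (2 * x)) with (xcot x - x * tan x) by (rewrite xcot_double by lra; ring).
    unfold plus, mult; simpl.
    set (D := PSeries _ _). rewrite xcot_neq0 by lra. unfold tan.
    pose proof (sin2_cos2 x) as T. unfold Rsqr in T.
    replace (-40 * x / (sin x * cos x))
      with (-40 * x * (sin x * sin x + cos x * cos x) / (sin x * cos x)) by (rewrite T, Rmult_1_r; reflexivity).
    field. lra.
Qed.

(** The combination of [is_derive_combination] vanishes at 0, and at [PI/4],
    where [sin^2] is 1/2, it is the sum of the two series. *)
Lemma PSeries_combination :
  PSeries harmonic_coef (1 / 2) + PSeries reciprocal_coef (1 / 2) = - (PI ^ 2 / 2) * ln 2.
Proof.
  pose proof PI_RGT_0.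
  set (f := fun x => -16 * ((PI / 2 - x) * xcot x) + 40 * ((PI / 4 - x) * xcot (2 * x))).
  set (G := fun t => (PI / 4 - t) * (2 * sin t * cos t * PSeries (PS_derive harmonic_coef) (sin t ^ 2))
              + PSeries harmonic_coef (sin t ^ 2) + PSeries reciprocal_coef (sin t ^ 2)
              + 24 * (PI / 4 - t) * t * xcot t).
  assert (Hlin : forall c x : R, continuous (fun t => c - t) x).
  { intros c x. apply (continuous_minus (fun _ => c) (fun t => t));
      [apply continuous_const|apply continuous_id]. }
  assert (Hmul : forall (c : R) (g : R -> R) (x : R),
    continuous g x -> continuous (fun t => c * g t) x).
  { intros c g x. apply (continuous_mult (fun _ => c) g), continuous_const. }
  assert (IG : is_RInt f 0 (PI / 4) (G (PI / 4) - G 0)).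
  { apply is_RInt_derive_open; [lra| | |].
    - intros x Hx. unfold f.
      apply (continuous_plus (fun x => -16 * ((PI / 2 - x) * xcot x))
               (fun x => 40 * ((PI / 4 - x) * xcot (2 * x)))).
      + apply Hmul.
        apply (continuous_mult (fun x => PI / 2 - x) xcot);
          [apply Hlin|apply continuous_xcot; lra].
      + apply Hmul.
        apply (continuous_mult (fun x => PI / 4 - x) (fun x => xcot (2 * x))); [apply Hlin|].
        apply (continuous_comp (fun x => 2 * x) xcot).
        * apply Hmul, continuous_id.
        * apply continuous_xcot. lra.
    - intros x Hx. unfold G.
      assert (HH := sin2_in_disk harmonic_coef x CV_radius_harmonic ltac:(lra)).
      assert (HI := sin2_in_disk reciprocal_coef x CV_radius_reciprocal ltac:(lra)).
      repeat apply (continuous_plus (V := R_NormedModule)).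
      + apply (continuous_mult (fun t => PI / 4 - t)
          (fun t => 2 * sin t * cos t * PSeries (PS_derive harmonic_coef) (sin t ^ 2))); [apply Hlin|].
        apply (ex_derive_continuous (V := R_NormedModule)). eexists.
        apply is_derive2_PSeries_sin2, HH.
      + apply (ex_derive_continuous (V := R_NormedModule)). eexists.
        apply is_derive_PSeries_sin2, HH.
      + apply (ex_derive_continuous (V := R_NormedModule)). eexists.
        apply is_derive_PSeries_sin2, HI.
      + apply (continuous_mult (fun t => 24 * (PI / 4 - t) * t) xcot);
          [|apply continuous_xcot; lra].
        apply (ex_derive_continuous (V := R_NormedModule)). auto_derive. exact I.
    - apply is_derive_combination. }
  pose proof (is_RInt_unique _ _ _ _ IG) as E.
  unfold f in E. rewrite (is_RInt_unique _ _ _ _ is_RInt_xcot_combination) in E. rewrite E.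
  unfold G. rewrite sin_0.
  replace (0 ^ 2) with 0 by ring. rewrite !PSeries_0.
  replace (harmonic_coef 0) with 0 by (unfold harmonic_coef; rewrite arcsin2_coef_0; ring).
  replace (reciprocal_coef 0) with 0 by (unfold reciprocal_coef; rewrite arcsin2_coef_0; ring).
  replace (sin (PI / 4) ^ 2) with (1 / 2).
  - ring.
  - rewrite sin_PI4. unfold Rdiv. rewrite Rpow_mult_distr, pow_inv, pow2_sqrt by lra. lra.
Qed.

Theorem mainTheorem11 :
  is_series
    (fun n : nat =>
       let k := S n in
       2 ^ k / (INR k ^ 2 * Binomial.C (2 * k) k)
       * (2 * S1 (2 * k) - 7 * S1 k + 2 / INR k))
    (- (PI ^ 2 / 2) * ln 2).
Proof.
  assert (Hr : forall a : nat -> R, Rbar_le 1 (CV_radius a) ->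
     is_pseries a (1 / 2) (PSeries a (1 / 2))).
  { intros a Ha. apply PSeries_correct, CV_radius_inside.
    apply Rbar_lt_le_trans with (2 := Ha). simpl. rewrite Rabs_pos_eq; lra. }
  pose proof (is_pseries_plus _ _ _ _ _ (Hr harmonic_coef CV_radius_harmonic) (Hr reciprocal_coef CV_radius_reciprocal)) as E.
  change (plus (PSeries harmonic_coef (1 / 2)) (PSeries reciprocal_coef (1 / 2)))
    with (PSeries harmonic_coef (1 / 2) + PSeries reciprocal_coef (1 / 2)) in E.
  rewrite PSeries_combination in E.
  apply is_pseries_R in E.
  apply (is_series_ext (fun n => PS_plus harmonic_coef reciprocal_coef (S n) * (1 / 2) ^ S n)).
  - intros n. cbv zeta. set (k := S n).
    change ((arcsin2_coef k * harmonic_weight k + arcsin2_coef k * (2 / INR k)) * (1 / 2) ^ k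
      = 2 ^ k / (INR k ^ 2 * Binomial.C (2 * k) k)
        * (2 * S1 (2 * k) - 7 * S1 k + 2 / INR k)).
    unfold arcsin2_coef, harmonic_weight.
    replace (2 ^ k) with (4 ^ k * (1 / 2) ^ k)
      by (rewrite <- Rpow_mult_distr; f_equal; field).
    unfold Rdiv. ring.
  - apply (is_series_incr_1 (V := R_NormedModule)
      (fun n => PS_plus harmonic_coef reciprocal_coef n * (1 / 2) ^ n)).
    change (is_series (fun n => PS_plus harmonic_coef reciprocal_coef n * (1 / 2) ^ n)
      (- (PI ^ 2 / 2) * ln 2 + (arcsin2_coef 0 * harmonic_weight 0 + arcsin2_coef 0 * (2 / INR 0)) * (1 / 2) ^ 0)).
    rewrite arcsin2_coef_0, !Rmult_0_l, Rplus_0_l, Rmult_0_l, Rplus_0_r. exact E.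
Qed.
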